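(* Let $r,s\in\mathbb{N}$. The following $q$-derivative formulas hold. (i) For $\mathbf{\Phi}_1$ (with $q^\gamma\neq 1,q^{-1},q^{-2},\dots$): $$\mathbb{D}_{x,q}^{r}\mathbf{\Phi}_{1}(q^{\alpha},q^{\beta};q^{\gamma};q,x,y)=\frac{(q^{\alpha};q)_{r}(q^{\beta};q)_{r}}{(q^{\gamma};q)_{r}(1-q)^{r}}\mathbf{\Phi}_{1}(q^{\alpha+r},q^{\beta+r};q^{\gamma+r};q,x,y),$$ $$\mathbb{D}_{y,q}^{s}\mathbf{\Phi}_{1}(q^{\alpha},q^{\beta};q^{\gamma};q,x,y)=\frac{(q^{\alpha};q)_{s}}{(q^{\gamma};q)_{s}(1-q)^{s}}\mathbf{\Phi}_{1}(q^{\alpha+s},q^{\beta};q^{\gamma+s};q,x,y),$$ $$\mathbb{D}_{x,q}^{r}\mathbb{D}_{y,q}^{s}\mathbf{\Phi}_{1}(q^{\alpha},q^{\beta};q^{\gamma};q,x,y)=\frac{(q^{\alpha};q)_{r+s}(q^{\beta};q)_{r}}{(q^{\gamma};q)_{r+s}(1-q)^{r+s}}\mathbf{\Phi}_{1}(q^{\alpha+r+s},q^{\beta+r};q^{\gamma+r+s};q,x,y).$$ (ii) For $\mathbf{\Phi}_2$ (with $q^\gamma\neq 1,q^{-1},q^{-2},\dots$): $$\mathbb{D}_{x,q}^{r}\mathbf{\Phi}_{2}(q^{\alpha},q^{\beta};q^{\gamma};q,x,y)=\frac{(q^{\alpha};q)_{r}}{(q^{\gamma};q)_{r}(1-q)^{r}}\mathbf{\Phi}_{2}(q^{\alpha+r},q^{\beta};q^{\gamma+r};q,x,y),$$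 $$\mathbb{D}_{y,q}^{s}\mathbf{\Phi}_{2}(q^{\alpha},q^{\beta};q^{\gamma};q,x,y)=\frac{(q^{\beta};q)_{s}}{(q^{\gamma};q)_{s}(1-q)^{s}}\mathbf{\Phi}_{2}(q^{\alpha},q^{\beta+s};q^{\gamma+s};q,x,y),$$ $$\mathbb{D}_{x,q}^{r}\mathbb{D}_{y,q}^{s}\mathbf{\Phi}_{2}(q^{\alpha},q^{\beta};q^{\gamma};q,x,y)=\frac{(q^{\alpha};q)_{r}(q^{\beta};q)_{s}}{(q^{\gamma};q)_{r+s}(1-q)^{r+s}}\mathbf{\Phi}_{2}(q^{\alpha+r},q^{\beta+s};q^{\gamma+r+s};q,x,y).$$ (iii) For $\mathbf{\Phi}_3$ (with $q^\beta\neq 1,q^{-1},q^{-2},\dots$): $$\mathbb{D}_{x,q}^{r}\mathbf{\Phi}_{3}(q^{\alpha};q^{\beta};q,x,y)=\frac{(q^{\alpha};q)_{r}}{(q^{\beta};q)_{r}(1-q)^{r}}\mathbf{\Phi}_{3}(q^{\alpha+r};q^{\beta+r};q,x,y),$$ $$\mathbb{D}_{y,q}^{s}\mathbf{\Phi}_{3}(q^{\alpha};q^{\beta};q,x,y)=\frac{1}{(q^{\beta};q)_{s}(1-q)^{s}}\mathbf{\Phi}_{3}(q^{\alpha};q^{\beta+s};q,x,y),$$ $$\mathbb{D}_{x,q}^{r}\mathbb{D}_{y,q}^{s}\mathbf{\Phi}_{3}(q^{\alpha};q^{\beta};q,x,y)=\frac{(q^{\alpha};q)_{r}}{(q^{\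beta};q)_{r+s}(1-q)^{r+s}}\mathbf{\Phi}_{3}(q^{\alpha+r};q^{\beta+r+s};q,x,y).$$
   Context: Let $q\in\mathbb{C}$ with $0<|q|<1$. The $q$-shifted factorial is $(a;q)_0=1$, $(a;q)_\ell=\prod_{j=0}^{\ell-1}(1-aq^j)$ for $\ell\ge 1$. The basic Humbert hypergeometric functions are defined by the double series $$\mathbf{\Phi}_{1}(q^{\alpha},q^{\beta};q^{\gamma};q,x,y)=\sum_{n,k=0}^{\infty}\frac{(q^{\alpha};q)_{n+k}(q^{\beta};q)_{n}}{(q^{\gamma};q)_{n+k}(q;q)_{n}(q;q)_{k}}x^{n}y^{k},$$ $$\mathbf{\Phi}_{2}(q^{\alpha},q^{\beta};q^{\gamma};q,x,y)=\sum_{n,k=0}^{\infty}\frac{(q^{\alpha};q)_{n}(q^{\beta};q)_{k}}{(q^{\gamma};q)_{n+k}(q;q)_{n}(q;q)_{k}}x^{n}y^{k},$$ $$\mathbf{\Phi}_{3}(q^{\alpha};q^{\beta};q,x,y)=\sum_{n,k=0}^{\infty}\frac{(q^{\alpha};q)_{n}}{(q^{\beta};q)_{n+k}(q;q)_{n}(q;q)_{k}}x^{n}y^{k},$$ where the denominator parameter ($q^\gamma$ for $\mathbf\Phi_1,\mathbf\Phi_2$; $q^\beta$ for $\mathbf\Phi_3$) is different from $1,q^{-1},q^{-2},\dots$. The Jackson $q$-difference operator is $\mathbb{D}_{z,q}\Psi(z)=\frac{\Psi(z)-\Psi(qz)}{(1-q)z}$, $z\ne0$; $\mathbb{D}_{x,q}$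 and $\mathbb{D}_{y,q}$ act in the variables $x$ and $y$ with the other variable fixed, and powers denote iteration. *)

(* Defs.v *)
From Stdlib Require Import Reals Lra Lia.
From Coquelicot Require Import Coquelicot.

Open Scope C_scope.

Definition Cexp (z : C) : C := (exp (Re z) * cos (Im z), exp (Re z) * sin (Im z))%R.

(* [qpow l alpha] is q^alpha, where l is the branch of log q fixed by the user
   (that is, [Cexp l = q]). *)
Definition qpow (l alpha : C) : C := Cexp (alpha * l).

(* (a;q)_n *)
Fixpoint qpoch (a q : C) (n : nat) : C :=
  match n with
  | O => 1
  | S m => qpoch a q m * (1 - a * q ^ m)
  end.

(* Coquelicot's total [Series] is real-valued. *)
Definition CSeries (u : nat -> C) : C :=
  (Series (fun n => Re (u n)), Series (fun n => Im (u n))).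

(* The sum of a double series is only used under [abs_summable], where the
   iterated sum agrees with every other order of summation. *)
Definition CSeries2 (t : nat -> nat -> C) : C :=
  CSeries (fun n => CSeries (fun k => t n k)).

Definition abs_summable (t : nat -> nat -> C) : Prop :=
  exists M : R, forall N K : nat,
    (sum_n (fun n => sum_n (fun k => Cmod (t n k)) K) N <= M)%R.

Definition Phi1_term (a b c q x y : C) (n k : nat) : C :=
  qpoch a q (n + k) * qpoch b q n
  / (qpoch c q (n + k) * qpoch q q n * qpoch q q k) * x ^ n * y ^ k.

Definition Phi2_term (a b c q x y : C) (n k : nat) : C :=
  qpoch a q n * qpoch b q k
  / (qpoch c q (n + k) * qpoch q q n * qpoch q q k) * x ^ n * y ^ k.

Definition Phi3_term (a b q x y : C) (n k : nat) : C :=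
  qpoch a q n
  / (qpoch b q (n + k) * qpoch q q n * qpoch q q k) * x ^ n * y ^ k.

Definition Phi1 (a b c q x y : C) : C := CSeries2 (Phi1_term a b c q x y).
Definition Phi2 (a b c q x y : C) : C := CSeries2 (Phi2_term a b c q x y).
Definition Phi3 (a b q x y : C) : C := CSeries2 (Phi3_term a b q x y).

(* Jackson's operator; meaningful for z <> 0 only. *)
Definition qD (q : C) (f : C -> C) (z : C) : C :=
  (f z - f (q * z)) / ((1 - q) * z).

Definition qDx (q : C) (F : C -> C -> C) : C -> C -> C :=
  fun x y => qD q (fun u => F u y) x.
Definition qDy (q : C) (F : C -> C -> C) : C -> C -> C :=
  fun x y => qD q (fun v => F x v) y.

(* The three series converge absolutely in the open unit bidisc (and possibly
   elsewhere, e.g. when they terminate); see [Phi1_summable], [Phi2_summable]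
   and [Phi3_summable] below. *)

Lemma prod_bound (B p : R) (u : nat -> R) :
  (0 <= B)%R -> (0 <= p < 1)%R -> u 0%nat = 1%R -> (forall n, 0 <= u n)%R ->
  (forall n, u (S n) <= u n * (1 + B * p ^ n))%R ->
  forall n, (u n <= exp (B / (1 - p)))%R.
Proof.
intros HB Hp H0 Hu HS n.
assert (H : (u n <= exp (B * ((1 - p ^ n) / (1 - p))))%R).
{ induction n as [|n IH].
  - rewrite H0; simpl.
    replace (B * ((1 - 1) / (1 - p)))%R with 0%R by (field; lra).
    rewrite exp_0; lra.
  - apply Rle_trans with (1 := HS n).
    replace (B * ((1 - p ^ S n) / (1 - p)))%R
      with (B * ((1 - p ^ n) / (1 - p)) + B * p ^ n)%R by (simpl; field; lra).
    rewrite exp_plus.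
    assert (Hpn : (0 <= p ^ n)%R) by (apply pow_le; lra).
    apply Rmult_le_compat; trivial.
    + nra.
    + apply exp_ineq1_le. }
apply Rle_trans with (1 := H).
assert (Hexp : forall a b : R, (a <= b -> exp a <= exp b)%R).
{ intros a b [Hab| ->]; [left; now apply exp_increasing | apply Rle_refl]. }
apply Hexp.
assert (Hpn : (0 <= p ^ n)%R) by (apply pow_le; lra).
unfold Rdiv; apply Rmult_le_compat_l; trivial.
rewrite <- (Rmult_1_l (/ (1 - p))) at 2.
apply Rmult_le_compat_r; [left; apply Rinv_0_lt_compat; lra | lra].
Qed.

Lemma qpoch_bound (a q : C) :
  (Cmod q < 1)%R -> exists M, (0 <= M)%R /\ forall n, (Cmod (qpoch a q n) <= M)%R.
Proof.
intros Hq; exists (exp (Cmod a / (1 - Cmod q))); split.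
{ left; apply exp_pos. }
apply (prod_bound (Cmod a) (Cmod q) (fun n => Cmod (qpoch a q n))).
- apply Cmod_ge_0.
- split; [apply Cmod_ge_0 | trivial].
- apply Cmod_1.
- intros; apply Cmod_ge_0.
- intros n; simpl; rewrite Cmod_mult.
  apply Rmult_le_compat_l; [apply Cmod_ge_0|].
  unfold Cminus; apply Rle_trans with (1 := Cmod_triangle _ _).
  rewrite Cmod_1, Cmod_opp, Cmod_mult, Cmod_pow; lra.
Qed.

Lemma eventually_lower (v : nat -> R) (N : nat) :
  (forall n, 0 < v n)%R -> (forall n, (N <= n)%nat -> / 2 <= v n)%R ->
  exists d, (0 < d)%R /\ forall n, (d <= v n)%R.
Proof.
intros Hv; induction N as [|N IH]; intros HN.
- exists (/ 2)%R; split; [lra | intros n; apply HN; lia].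
- assert (H : exists d, (0 < d)%R /\ forall n, (n < S N)%nat -> (d <= v n)%R).
  { clear - Hv; induction (S N) as [|m [d [Hd IHd]]].
    - exists 1%R; split; [lra | intros; lia].
    - exists (Rmin d (v m)); split; [now apply Rmin_pos|].
      intros n Hn; destruct (Nat.eq_dec n m) as [->|Hnm]; [apply Rmin_r|].
      apply Rle_trans with (1 := Rmin_l _ _), IHd; lia. }
  destruct H as [d [Hd H]]; exists (Rmin d (/ 2)); split.
  { apply Rmin_pos; lra. }
  intros n; destruct (Nat.lt_ge_cases n (S N)) as [Hn|Hn].
  + apply Rle_trans with (1 := Rmin_l _ _); auto.
  + apply Rle_trans with (1 := Rmin_r _ _); auto.
Qed.

Lemma Cmod_one_minus (z : C) : (1 <= Cmod (1 - z) + Cmod z)%R.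
Proof.
assert (H := Cmod_triangle (1 - z) z).
replace (1 - z + z) with (RtoC 1) in H by ring.
now rewrite Cmod_1 in H.
Qed.

Lemma qpoch_inv_bound (c q : C) :
  (Cmod q < 1)%R -> (forall n, c * q ^ n <> 1) ->
  (forall n, qpoch c q n <> 0) /\
  exists M, (0 <= M)%R /\ forall n, (/ Cmod (qpoch c q n) <= M)%R.
Proof.
intros Hq Hc.
assert (Hf : forall n, 1 - c * q ^ n <> 0).
{ intros n H; apply (Hc n).
  replace (c * q ^ n) with (1 - (1 - c * q ^ n)) by ring; rewrite H; ring. }
assert (Hp : forall n, qpoch c q n <> 0).
{ induction n as [|n IH]; simpl; [apply C1_nz | now apply Cmult_neq_0]. }
split; trivial.
assert (Hq0 : (0 <= Cmod q)%R) by apply Cmod_ge_0.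
assert (Hc0 : (0 <= Cmod c)%R) by apply Cmod_ge_0.
assert (Hd : exists d, (0 < d)%R /\ forall n, (d <= Cmod (1 - c * q ^ n))%R).
{ destruct (pow_lt_1_zero (Cmod q) (ltac:(rewrite Rabs_pos_eq; trivial))
    (/ (2 * (Cmod c + 1)))%R) as [N HN].
  { apply Rinv_0_lt_compat; lra. }
  apply eventually_lower with N.
  - intros n; now apply Cmod_gt_0.
  - intros n Hn; specialize (HN n Hn).
    rewrite Rabs_pos_eq in HN by (apply pow_le; trivial).
    assert (H1 : (1 <= Cmod (1 - c * q ^ n) + Cmod c * Cmod q ^ n)%R).
    { rewrite <- Cmod_pow, <- Cmod_mult; apply Cmod_one_minus. }
    assert (H2 : (Cmod c * Cmod q ^ n <= / 2)%R).
    { apply Rle_trans with (Cmod c * / (2 * (Cmod c + 1)))%R.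
      - apply Rmult_le_compat_l; lra.
      - apply Rmult_le_reg_r with (2 * (Cmod c + 1))%R; [lra|].
        rewrite Rmult_assoc, Rinv_l; lra. }
    lra. }
destruct Hd as [d [Hd0 Hd]].
exists (exp (Cmod c / d / (1 - Cmod q))); split.
{ left; apply exp_pos. }
apply (prod_bound (Cmod c / d) (Cmod q) (fun n => / Cmod (qpoch c q n))%R).
- apply Rdiv_le_0_compat; lra.
- lra.
- simpl; rewrite Cmod_1; apply Rinv_1.
- intros n; left; apply Rinv_0_lt_compat, Cmod_gt_0, Hp.
- intros n; simpl; rewrite Cmod_mult, Rinv_mult.
  apply Rmult_le_compat_l.
  { left; apply Rinv_0_lt_compat, Cmod_gt_0, Hp. }
  specialize (Hd n); set (w := Cmod (1 - c * q ^ n)) in *.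
  assert (Hpn : (0 <= Cmod q ^ n)%R) by (apply pow_le; trivial).
  assert (H1 : (1 <= w + Cmod c * Cmod q ^ n)%R).
  { unfold w; rewrite <- Cmod_pow, <- Cmod_mult; apply Cmod_one_minus. }
  apply Rmult_le_reg_l with w; [lra|].
  rewrite Rinv_r by lra.
  assert (H2 : (1 <= w / d)%R).
  { apply Rmult_le_reg_r with d; trivial.
    unfold Rdiv; rewrite Rmult_assoc, Rinv_l; lra. }
  replace (w * (1 + Cmod c / d * Cmod q ^ n))%R
    with (w + w / d * (Cmod c * Cmod q ^ n))%R by (field; lra).
  assert (0 <= Cmod c * Cmod q ^ n)%R by now apply Rmult_le_pos.
  nra.
Qed.

Lemma sum_geom_le (X : R) (N : nat) :
  (0 <= X < 1)%R -> (sum_n (fun n => X ^ n) N <= / (1 - X))%R.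
Proof.
intros HX.
assert (HN : (0 <= X ^ S N)%R) by (apply pow_le; lra).
rewrite sum_n_Reals, tech3 by lra.
unfold Rdiv; rewrite <- (Rmult_1_l (/ (1 - X))) at 2.
apply Rmult_le_compat_r; [left; apply Rinv_0_lt_compat|]; lra.
Qed.

Lemma geom_summable (t : nat -> nat -> C) (B X Y : R) :
  (0 <= B)%R -> (0 <= X < 1)%R -> (0 <= Y < 1)%R ->
  (forall n k, Cmod (t n k) <= B * X ^ n * Y ^ k)%R -> abs_summable t.
Proof.
intros HB HX HY Ht; exists (B * / (1 - X) * / (1 - Y))%R; intros N K.
apply Rle_trans with (sum_n (fun n => (B * / (1 - Y)) * X ^ n)%R N).
- apply sum_n_m_le; intros n.
  apply Rle_trans with (sum_n (fun k => (B * X ^ n) * Y ^ k)%R K).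
  + apply sum_n_m_le; intros k; apply Ht.
  + apply Rle_trans with (B * X ^ n * sum_n (fun k => Y ^ k)%R K)%R.
    { apply Req_le; exact (sum_n_mult_l (K := R_Ring) (B * X ^ n)%R (fun k => Y ^ k)%R K). }
    replace (B * / (1 - Y) * X ^ n)%R with (B * X ^ n * / (1 - Y))%R by ring.
    apply Rmult_le_compat_l; [|now apply sum_geom_le].
    apply Rmult_le_pos; [|apply pow_le]; lra.
- apply Rle_trans with (B * / (1 - Y) * sum_n (fun n => X ^ n)%R N)%R.
  { apply Req_le; exact (sum_n_mult_l (K := R_Ring) (B * / (1 - Y))%R (fun n => X ^ n)%R N). }
  replace (B * / (1 - X) * / (1 - Y))%R with (B * / (1 - Y) * / (1 - X))%R by ring.
  apply Rmult_le_compat_l; [|now apply sum_geom_le].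
  apply Rmult_le_pos; trivial; left; apply Rinv_0_lt_compat; lra.
Qed.

Lemma pow_not_1 (q : C) (n : nat) : (Cmod q < 1)%R -> q * q ^ n <> 1.
Proof.
intros Hq H.
assert (E : (Cmod q * Cmod q ^ n = 1)%R) by now rewrite <- Cmod_pow, <- Cmod_mult, H, Cmod_1.
assert (H0 := Cmod_ge_0 q).
assert (H1 : (Cmod q ^ n <= 1)%R).
{ rewrite <- (pow1 n); apply pow_incr; lra. }
assert (H2 : (0 <= Cmod q ^ n)%R) by (apply pow_le; lra).
nra.
Qed.

Lemma bidisc_summable (c q x y : C) (num : nat -> nat -> C) (M : R) :
  (0 < Cmod q < 1)%R -> (forall n, c <> / q ^ n) ->
  (Cmod x < 1)%R -> (Cmod y < 1)%R ->
  (forall n k, Cmod (num n k) <= M)%R ->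
  abs_summable (fun n k =>
    num n k / (qpoch c q (n + k) * qpoch q q n * qpoch q q k) * x ^ n * y ^ k).
Proof.
intros Hq Hc Hx Hy HM.
assert (Hq0 : q <> 0) by (apply Cmod_gt_0; lra).
assert (M0 : (0 <= M)%R) by (apply Rle_trans with (2 := HM 0%nat 0%nat), Cmod_ge_0).
destruct (qpoch_inv_bound c q) as [Zc [A [A0 HA]]]; [lra| |].
{ intros n H; apply (Hc n).
  assert (Hn := Cpow_nz q n Hq0).
  replace c with ((c * q ^ n) / q ^ n) by (field; trivial).
  rewrite H; field; trivial. }
destruct (qpoch_inv_bound q q) as [Zq [B [B0 HB]]]; [lra| |].
{ intros n; apply pow_not_1; lra. }
apply (geom_summable _ (M * (A * B * B))%R (Cmod x) (Cmod y)).
- repeat apply Rmult_le_pos; trivial.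
- split; [apply Cmod_ge_0 | trivial].
- split; [apply Cmod_ge_0 | trivial].
- intros n k.
  unfold Cdiv; rewrite !Cmod_mult, !Cmod_pow, Cmod_inv by (repeat apply Cmult_neq_0; trivial).
  rewrite !Cmod_mult, !Rinv_mult.
  assert (Pinv : forall z : C, z <> 0 -> (0 <= / Cmod z)%R).
  { intros z Hz; left; apply Rinv_0_lt_compat, Cmod_gt_0, Hz. }
  apply Rmult_le_compat_r; [apply pow_le, Cmod_ge_0|].
  apply Rmult_le_compat_r; [apply pow_le, Cmod_ge_0|].
  apply Rmult_le_compat; trivial; try apply Cmod_ge_0.
  + repeat apply Rmult_le_pos; auto.
  + apply Rmult_le_compat; auto.
    * apply Rmult_le_pos; auto.
    * apply Rmult_le_compat; auto.
Qed.

Lemma Phi1_summable (a b c q x y : C) :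
  (0 < Cmod q < 1)%R -> (forall n, c <> / q ^ n) ->
  (Cmod x < 1)%R -> (Cmod y < 1)%R -> abs_summable (Phi1_term a b c q x y).
Proof.
intros Hq Hc Hx Hy.
destruct (qpoch_bound a q) as [A [A0 HA]]; [lra|].
destruct (qpoch_bound b q) as [B [B0 HB]]; [lra|].
apply (bidisc_summable c q x y (fun n k => qpoch a q (n + k) * qpoch b q n) (A * B)%R);
  trivial.
intros n k; rewrite Cmod_mult; apply Rmult_le_compat; trivial; apply Cmod_ge_0.
Qed.

Lemma Phi2_summable (a b c q x y : C) :
  (0 < Cmod q < 1)%R -> (forall n, c <> / q ^ n) ->
  (Cmod x < 1)%R -> (Cmod y < 1)%R -> abs_summable (Phi2_term a b c q x y).
Proof.
intros Hq Hc Hx Hy.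
destruct (qpoch_bound a q) as [A [A0 HA]]; [lra|].
destruct (qpoch_bound b q) as [B [B0 HB]]; [lra|].
apply (bidisc_summable c q x y (fun n k => qpoch a q n * qpoch b q k) (A * B)%R);
  trivial.
intros n k; rewrite Cmod_mult; apply Rmult_le_compat; trivial; apply Cmod_ge_0.
Qed.

Lemma Phi3_summable (a b q x y : C) :
  (0 < Cmod q < 1)%R -> (forall n, b <> / q ^ n) ->
  (Cmod x < 1)%R -> (Cmod y < 1)%R -> abs_summable (Phi3_term a b q x y).
Proof.
intros Hq Hb Hx Hy.
destruct (qpoch_bound a q) as [A [A0 HA]]; [lra|].
apply (bidisc_summable b q x y (fun n _ => qpoch a q n) A); trivial.
Qed.

(* Main.v *)
(** Write each series as the sum of A(n,k) x^n y^k / ((q;q)_n (q;q)_k).  Since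
    (q;q)_(n+1) = (q;q)_n (1 - q^(n+1)), applying Jackson's operator in x (in y)
    replaces A(n,k) by A(n+1,k) (by A(n,k+1)) and divides by 1 - q; absolute
    convergence at (x,y) persists at smaller moduli, in particular at (qx,y)
    and (x,qy), and under these shifts.  The formulas then follow from
    (a;q)_(m+n) = (a;q)_m (a q^m;q)_n applied to A(r+n,s+k). *)
Require Import Defs.
From Stdlib Require Import Reals Lra Lia FunctionalExtensionality.
From Coquelicot Require Import Coquelicot.
Open Scope C_scope.

(** * Series and partial sums of nonnegative reals *)

Lemma ex_series_bounded (a : nat -> R) (M : R) :
  (forall n, 0 <= a n)%R -> (forall n, sum_n a n <= M)%R -> ex_series a.
Proof.
intros Ha HM.
destruct (ex_finite_lim_seq_incr (sum_n a) M) as [l Hl]; trivial.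
- intros n; rewrite sum_Sn; unfold plus; simpl; specialize (Ha (S n)); lra.
- exists l; exact Hl.
Qed.

Lemma sum_n_nonneg (a : nat -> R) (N : nat) :
  (forall n, 0 <= a n)%R -> (0 <= sum_n a N)%R.
Proof.
intros Ha; induction N as [|N IH].
- rewrite sum_O; apply Ha.
- rewrite sum_Sn; unfold plus; simpl; specialize (Ha (S N)); lra.
Qed.

Lemma sum_n_shift_le (a : nat -> R) (N : nat) :
  (forall n, 0 <= a n)%R -> (sum_n (fun n => a (S n)) N <= sum_n a (S N))%R.
Proof.
intros Ha; unfold sum_n at 1.
rewrite sum_n_m_S; unfold sum_n.
rewrite (sum_Sn_m a 0 (S N)) by lia.
unfold plus; simpl; specialize (Ha 0%nat); lra.
Qed.

Lemma sum_n_le_index (a : nat -> R) (N : nat) :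
  (forall n, 0 <= a n)%R -> (a N <= sum_n a N)%R.
Proof.
intros Ha; destruct N as [|N].
- rewrite sum_O; lra.
- rewrite sum_Sn; unfold plus; simpl.
  assert (H := sum_n_nonneg a N Ha); lra.
Qed.

(** * Absolutely convergent complex series, by components *)

Lemma im_le_Cmod (z : C) : (Rabs (Im z) <= Cmod z)%R.
Proof. exact (Rle_trans _ _ _ (Rmax_r _ _) (Rmax_Cmod z)). Qed.

Lemma Cmod_le_re_im (z : C) : (Cmod z <= Rabs (Re z) + Rabs (Im z))%R.
Proof.
replace z with (RtoC (Re z) + Ci * RtoC (Im z)) at 1
  by (destruct z; unfold Ci, RtoC, Cplus, Cmult; simpl; f_equal; ring).
apply Rle_trans with (1 := Cmod_triangle _ _).
rewrite Cmod_mult, !Cmod_R, Cmod_Ci; lra.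
Qed.

Lemma ex_series_Re (u : nat -> C) :
  ex_series (fun n => Cmod (u n)) -> ex_series (fun n => Re (u n)).
Proof.
apply (ex_series_le (V := R_CompleteNormedModule)); intros n; apply re_le_Cmod.
Qed.

Lemma ex_series_Im (u : nat -> C) :
  ex_series (fun n => Cmod (u n)) -> ex_series (fun n => Im (u n)).
Proof.
apply (ex_series_le (V := R_CompleteNormedModule)); intros n; apply im_le_Cmod.
Qed.

Lemma CSeries_ext (u v : nat -> C) :
  (forall n, u n = v n) -> CSeries u = CSeries v.
Proof.
intros H; unfold CSeries; f_equal; apply Series_ext; intros n; now rewrite H.
Qed.

Lemma CSeries_minus (u v : nat -> C) :
  ex_series (fun n => Cmod (u n)) -> ex_series (fun n => Cmod (v n)) ->
  CSeries (fun n => u n - v n) = CSeries u - CSeries v.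
Proof.
intros Hu Hv; apply injective_projections.
- exact (Series_minus _ _ (ex_series_Re u Hu) (ex_series_Re v Hv)).
- exact (Series_minus _ _ (ex_series_Im u Hu) (ex_series_Im v Hv)).
Qed.

(** Each component of [c * u n] mixes both components of [u n], so both goals use convergence of the
    real and of the imaginary series. *)
Lemma CSeries_scal (c : C) (u : nat -> C) :
  ex_series (fun n => Cmod (u n)) -> CSeries (fun n => c * u n) = c * CSeries u.
Proof.
intros Hu.
assert (Hr := fun a : R => ex_series_scal_l (V := R_NormedModule) a _ (ex_series_Re u Hu)).
assert (Hi := fun a : R => ex_series_scal_l (V := R_NormedModule) a _ (ex_series_Im u Hu)).
apply injective_projections; simpl; rewrite <- !Series_scal_l.
- exact (Series_minus _ _ (Hr (fst c)) (Hi (snd c))).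
- exact (Series_plus _ _ (Hi (fst c)) (Hr (snd c))).
Qed.

(** With a zero first term the partial sums agree up to an index shift, so the total [Series] gives
    the same value even when [u] diverges. *)
Lemma CSeries_shift (u : nat -> C) :
  u 0%nat = 0 -> CSeries u = CSeries (fun n => u (S n)).
Proof.
intros H; unfold CSeries.
now rewrite (Series_incr_1_aux (fun n => Re (u n))), (Series_incr_1_aux (fun n => Im (u n)))
  by now rewrite H.
Qed.

Lemma CSeries_zero (u : nat -> C) : (forall n, u n = 0) -> CSeries u = 0.
Proof.
(* Writing the zero term as [0 * 0] lets the scalar rule pull a factor 0 out of the series. *)
intros H; rewrite (CSeries_ext _ (fun _ => 0 * 0)) by (intros n; rewrite H; ring).
rewrite CSeries_scal; [ring|].
apply ex_series_bounded with 0%R; intros n.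
- apply Cmod_ge_0.
- rewrite sum_n_const, Cmod_0; lra.
Qed.

(** The factor 2 arises from bounding the real and imaginary parts separately by the series of
    moduli; later only finiteness of the bound matters. *)
Lemma Cmod_CSeries_le (u : nat -> C) :
  ex_series (fun n => Cmod (u n)) ->
  (Cmod (CSeries u) <= 2 * Series (fun n => Cmod (u n)))%R.
Proof.
intros Hu; apply Rle_trans with (1 := Cmod_le_re_im _); simpl.
assert (H : forall f : C -> R, (forall z, Rabs (f z) <= Cmod z)%R ->
  (Rabs (Series (fun n => f (u n))) <= Series (fun n => Cmod (u n)))%R).
{ intros f Hf; apply Rle_trans with (Series (fun n => Rabs (f (u n)))).
  - apply Series_Rabs.
    apply (ex_series_le (V := R_CompleteNormedModule)) with (2 := Hu).
    intros n; unfold norm; simpl; unfold abs; simpl; rewrite Rabs_Rabsolu; apply Hf.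
  - apply Series_le; trivial; intros n; split; [apply Rabs_pos | apply Hf]. }
assert (H1 := H Re re_le_Cmod); assert (H2 := H Im im_le_Cmod); lra.
Qed.

(** * Absolutely summable double families *)

(** A partial sum of row [n] is part of the sum over a rectangle that reaches row [n]. *)
Lemma abs_summable_row (t : nat -> nat -> C) (n : nat) :
  abs_summable t -> ex_series (fun k => Cmod (t n k)).
Proof.
intros [M HM]; apply ex_series_bounded with M.
- intros k; apply Cmod_ge_0.
- intros K; apply Rle_trans with (2 := HM n K).
  apply (sum_n_le_index (fun n => sum_n (fun k => Cmod (t n k)) K)).
  intros m; apply sum_n_nonneg; intros k; apply Cmod_ge_0.
Qed.

(** Provides absolute convergence of the outer series in [CSeries2], by comparison with twice the
    row sums of moduli. *)
Lemma abs_summable_rows (t : nat -> nat -> C) :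
  abs_summable t -> ex_series (fun n => Cmod (CSeries (t n))).
Proof.
intros Ht; assert (Hrow := fun n => abs_summable_row t n Ht).
destruct Ht as [M HM].
apply (ex_series_le (V := R_CompleteNormedModule)) with
  (b := fun n => (2 * Series (fun k => Cmod (t n k)))%R).
{ intros n; unfold norm; simpl; unfold abs; simpl.
  rewrite Rabs_pos_eq by apply Cmod_ge_0.
  now apply Cmod_CSeries_le. }
apply (ex_series_scal_l (V := R_NormedModule)).
apply ex_series_bounded with M.
- intros n.
  (* Nonnegativity of a series comes from comparing it with 0 times itself. *)
  rewrite <- (Rmult_0_l (Series (fun k => Cmod (t n k)))), <- Series_scal_l.
  apply Series_le; trivial.
  intros k; rewrite Rmult_0_l; split; [lra | apply Cmod_ge_0].
- intros N.
  (* For fixed [N], letting [K] tend to infinity in the rectangle bound [M] bounds the first [N + 1]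
     row sums. *)
  assert (HL : is_lim_seq (fun K => sum_n (fun n => sum_n (fun k => Cmod (t n k)) K) N)
    (sum_n (fun n => Series (fun k => Cmod (t n k))) N)).
  { induction N as [|N IH].
    - rewrite sum_O.
      apply is_lim_seq_ext with (sum_n (fun k => Cmod (t 0%nat k))).
      { intros K; now rewrite sum_O. }
      exact (Series_correct _ (Hrow 0%nat)).
    - rewrite sum_Sn.
      apply is_lim_seq_ext with (fun K => (sum_n (fun n => sum_n (fun k => Cmod (t n k)) K) N
        + sum_n (fun k => Cmod (t (S N) k)) K)%R).
      { intros K; now rewrite sum_Sn. }
      apply is_lim_seq_plus'; trivial.
      exact (Series_correct _ (Hrow (S N))). }
  exact (is_lim_seq_le _ _ _ _ (HM N) HL (is_lim_seq_const M)).
Qed.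

Lemma abs_summable_le (B : R) (t u : nat -> nat -> C) :
  (0 <= B)%R -> (forall n k, Cmod (t n k) <= B * Cmod (u n k))%R ->
  abs_summable u -> abs_summable t.
Proof.
intros HB H [M HM]; exists (B * M)%R; intros N K.
apply Rle_trans with (B * sum_n (fun n => sum_n (fun k => Cmod (u n k)) K) N)%R.
2: now apply Rmult_le_compat_l.
rewrite <- (sum_n_mult_l (K := R_Ring)).
apply sum_n_m_le; intros n.
rewrite <- (sum_n_mult_l (K := R_Ring)).
apply sum_n_m_le; intros k; apply H.
Qed.

(** Used to divide out [x] or [y] after an index shift, which is where nonzero variables enter the
    summability arguments. *)
Lemma abs_summable_unscal (c : C) (t : nat -> nat -> C) :
  c <> 0 -> abs_summable (fun n k => c * t n k) -> abs_summable t.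
Proof.
intros Hc; apply abs_summable_le with (/ Cmod c)%R.
- left; now apply Rinv_0_lt_compat, Cmod_gt_0.
- intros n k; rewrite Cmod_mult, <- Rmult_assoc, Rinv_l; [lra|].
  apply Rgt_not_eq; now apply Cmod_gt_0.
Qed.

Lemma abs_summable_shift_l (t : nat -> nat -> C) :
  abs_summable t -> abs_summable (fun n k => t (S n) k).
Proof.
intros [M HM]; exists M; intros N K.
apply Rle_trans with (2 := HM (S N) K).
apply (sum_n_shift_le (fun n => sum_n (fun k => Cmod (t n k)) K)).
intros n; apply sum_n_nonneg; intros k; apply Cmod_ge_0.
Qed.

Lemma abs_summable_shift_r (t : nat -> nat -> C) :
  abs_summable t -> abs_summable (fun n k => t n (S k)).
Proof.
intros [M HM]; exists M; intros N K.
apply Rle_trans with (2 := HM N (S K)).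
apply sum_n_m_le; intros n.
apply (sum_n_shift_le (fun k => Cmod (t n k))); intros k; apply Cmod_ge_0.
Qed.

(** * Algebra and index shifts of double sums *)

Lemma CSeries2_ext (t u : nat -> nat -> C) :
  (forall n k, t n k = u n k) -> CSeries2 t = CSeries2 u.
Proof. intros H; apply CSeries_ext; intros n; now apply CSeries_ext. Qed.

Lemma CSeries2_minus (t u : nat -> nat -> C) :
  abs_summable t -> abs_summable u ->
  CSeries2 (fun n k => t n k - u n k) = CSeries2 t - CSeries2 u.
Proof.
intros Ht Hu; unfold CSeries2.
rewrite <- CSeries_minus by now apply abs_summable_rows.
apply CSeries_ext; intros n.
now apply CSeries_minus; apply abs_summable_row.
Qed.

(* Requiring the scaled family to be summable, rather than [t] itself, covers
   the case [c = 0] for arbitrary [t]. *)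
Lemma CSeries2_scal (c : C) (t : nat -> nat -> C) :
  abs_summable (fun n k => c * t n k) ->
  CSeries2 (fun n k => c * t n k) = c * CSeries2 t.
Proof.
intros H; destruct (Ceq_dec c 0) as [->|Hc].
- rewrite Cmult_0_l; apply CSeries_zero; intros n.
  apply CSeries_zero; intros k; ring.
- assert (Ht := abs_summable_unscal c t Hc H).
  unfold CSeries2; rewrite <- CSeries_scal by now apply abs_summable_rows.
  apply CSeries_ext; intros n; now apply CSeries_scal, abs_summable_row.
Qed.

Lemma CSeries2_shift_l (t : nat -> nat -> C) :
  (forall k, t 0%nat k = 0) -> CSeries2 t = CSeries2 (fun n k => t (S n) k).
Proof. intros H; apply CSeries_shift; now apply CSeries_zero. Qed.

Lemma CSeries2_shift_r (t : nat -> nat -> C) :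
  (forall n, t n 0%nat = 0) -> CSeries2 t = CSeries2 (fun n k => t n (S k)).
Proof. intros H; apply CSeries_ext; intros n; now apply CSeries_shift. Qed.

(** * Powers of [q] and [q]-shifted factorials *)

Lemma Cexp_plus (z w : C) : Cexp (z + w) = Cexp z * Cexp w.
Proof.
unfold Cexp; rewrite re_plus, im_plus, exp_plus, cos_plus, sin_plus.
apply injective_projections; simpl; ring.
Qed.

(** Since [l] is a logarithm of [q], adding 1 to the exponent multiplies by [q]. This turns exponent
    shifts into factors [q ^ n], so the series can be treated with arbitrary complex parameters. *)
Lemma qpow_add_INR (q l alpha : C) (n : nat) :
  Cexp l = q -> qpow l (alpha + INR n) = qpow l alpha * q ^ n.
Proof.
intros <-; induction n as [|n IH]; simpl Cpow.
- now rewrite Cmult_1_r, Cplus_0_r.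
- rewrite S_INR, RtoC_plus.
  replace (qpow l (alpha + (INR n + 1))) with (qpow l (alpha + INR n) * Cexp l).
  + rewrite IH; ring.
  + unfold qpow; rewrite <- Cexp_plus; apply f_equal; ring.
Qed.

Lemma qpoch_add (a q : C) (m n : nat) :
  qpoch a q (m + n) = qpoch a q m * qpoch (a * q ^ m) q n.
Proof.
induction n as [|n IH].
- rewrite Nat.add_0_r; simpl; ring.
- rewrite Nat.add_succ_r; simpl; rewrite IH, Cpow_add_r; ring.
Qed.

(** The condition on [c] says that [c * q ^ n] is never 1, so no factor of the product vanishes. *)
Lemma qpoch_nz (c q : C) :
  (0 < Cmod q < 1)%R -> (forall n, c <> / q ^ n) -> forall n, qpoch c q n <> 0.
Proof.
intros Hq Hc; assert (Hq0 : q <> 0) by (apply Cmod_gt_0; lra).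
apply qpoch_inv_bound; [lra|].
intros n H; apply (Hc n).
assert (Hn := Cpow_nz q n Hq0).
replace c with ((c * q ^ n) / q ^ n) by (field; trivial).
rewrite H; field; trivial.
Qed.

Lemma qpoch_self_nz (q : C) (n : nat) : (Cmod q < 1)%R -> qpoch q q n <> 0.
Proof.
intros Hq; apply qpoch_inv_bound; trivial.
intros m; now apply pow_not_1.
Qed.

Lemma one_minus_nz (q : C) : (Cmod q < 1)%R -> 1 - q <> 0.
Proof.
intros Hq H; apply (pow_not_1 q 0 Hq); simpl.
replace (q * 1) with (1 - (1 - q)) by ring; rewrite H; ring.
Qed.

(** Source of the constant 2 in the summability of shifted families. *)
Lemma Cmod_one_minus_pow (q : C) (n : nat) :
  (Cmod q < 1)%R -> (Cmod (1 - q ^ n) <= 2)%R.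
Proof.
intros Hq; unfold Cminus; apply Rle_trans with (1 := Cmod_triangle _ _).
rewrite Cmod_1, Cmod_opp, Cmod_pow.
assert (H : (Cmod q ^ n <= 1)%R); [|lra].
rewrite <- (pow1 n); apply pow_incr; split; [apply Cmod_ge_0 | lra].
Qed.

Lemma Cmod_qmult_le (q x : C) : (Cmod q < 1)%R -> (Cmod (q * x) <= Cmod x)%R.
Proof.
intros Hq; rewrite Cmod_mult; assert (H := Cmod_ge_0 x); nra.
Qed.

(** * Normalised double power series and their differences *)

(* Dividing the coefficients by [(q;q)_n (q;q)_k] makes Jackson's operators act
   as index shifts on [A]. *)
Definition qterm (q : C) (A : nat -> nat -> C) (x y : C) (n k : nat) : C :=
  A n k / (qpoch q q n * qpoch q q k) * x ^ n * y ^ k.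

Definition qsum (q : C) (A : nat -> nat -> C) (x y : C) : C :=
  CSeries2 (qterm q A x y).

Lemma qterm_summable_le (q : C) (A : nat -> nat -> C) (x y x' y' : C) :
  (Cmod x' <= Cmod x)%R -> (Cmod y' <= Cmod y)%R ->
  abs_summable (qterm q A x y) -> abs_summable (qterm q A x' y').
Proof.
intros Hx Hy; apply abs_summable_le with 1%R; [lra|]; intros n k.
unfold qterm; rewrite !Cmod_mult, !Cmod_pow, Rmult_1_l.
apply Rmult_le_compat; try apply pow_incr; try (split; trivial); try apply Cmod_ge_0.
- apply Rmult_le_pos; [|apply pow_le]; apply Cmod_ge_0.
- apply pow_le, Cmod_ge_0.
- apply Rmult_le_compat_l; [apply Cmod_ge_0|].
  apply pow_incr; split; trivial; apply Cmod_ge_0.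
Qed.

(** The factor [1 - q ^ S n] cancels the last factor of [qpoch q q (S n)]. Keeping [x] as a
    multiplier makes the identity valid at [x = 0] too. *)
Lemma qterm_succ_l (q : C) (A : nat -> nat -> C) (x y : C) (n k : nat) :
  (Cmod q < 1)%R ->
  (1 - q ^ S n) * qterm q A x y (S n) k = x * qterm q (fun n k => A (S n) k) x y n k.
Proof.
intros Hq; assert (Hn := qpoch_self_nz q (S n) Hq); assert (Hk := qpoch_self_nz q k Hq).
unfold qterm; simpl in *; field; repeat split; trivial.
(* The two remaining conditions concern the factors of [qpoch q q (S n)]; if either vanished, so
   would the product. *)
- intros H; apply Hn; rewrite H; ring.
- intros H; apply Hn; rewrite H; ring.
Qed.

Lemma qterm_succ_r (q : C) (A : nat -> nat -> C) (x y : C) (n k : nat) :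
  (Cmod q < 1)%R ->
  (1 - q ^ S k) * qterm q A x y n (S k) = y * qterm q (fun n k => A n (S k)) x y n k.
Proof.
intros Hq; assert (Hn := qpoch_self_nz q n Hq); assert (Hk := qpoch_self_nz q (S k) Hq).
unfold qterm; simpl in *; field; repeat split; trivial.
- intros H; apply Hk; rewrite H; ring.
- intros H; apply Hk; rewrite H; ring.
Qed.

(** By [qterm_succ_l] these terms are the index-shifted terms of the original family times
    [1 - q ^ S n], hence at most doubled in modulus. *)
Lemma qterm_summable_scal_l (q : C) (A : nat -> nat -> C) (x y : C) :
  (Cmod q < 1)%R -> abs_summable (qterm q A x y) ->
  abs_summable (fun n k => x * qterm q (fun n k => A (S n) k) x y n k).
Proof.
intros Hq HA; apply abs_summable_shift_l in HA; revert HA.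
apply abs_summable_le with 2%R; [lra|]; intros n k.
rewrite <- qterm_succ_l, Cmod_mult by trivial.
apply Rmult_le_compat_r; [apply Cmod_ge_0 | now apply Cmod_one_minus_pow].
Qed.

Lemma qterm_summable_scal_r (q : C) (A : nat -> nat -> C) (x y : C) :
  (Cmod q < 1)%R -> abs_summable (qterm q A x y) ->
  abs_summable (fun n k => y * qterm q (fun n k => A n (S k)) x y n k).
Proof.
intros Hq HA; apply abs_summable_shift_r in HA; revert HA.
apply abs_summable_le with 2%R; [lra|]; intros n k.
rewrite <- qterm_succ_r, Cmod_mult by trivial.
apply Rmult_le_compat_r; [apply Cmod_ge_0 | now apply Cmod_one_minus_pow].
Qed.

(** Each unit shift divides by [x]. The alternative [r = 0] shifts nothing, so formulas
    differentiating only in [y] remain available at [x = 0]. *)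
Lemma qterm_summable_add_l (q : C) (A : nat -> nat -> C) (r : nat) (x y : C) :
  (Cmod q < 1)%R -> r = 0%nat \/ x <> 0 -> abs_summable (qterm q A x y) ->
  abs_summable (qterm q (fun n k => A (r + n)%nat k) x y).
Proof.
intros Hq [-> | Hx]; trivial.
revert A; induction r as [|r IH]; intros A HA; trivial.
apply (IH (fun n k => A (S n) k)), (abs_summable_unscal x); trivial.
now apply qterm_summable_scal_l.
Qed.

Lemma qterm_summable_add_r (q : C) (A : nat -> nat -> C) (s : nat) (x y : C) :
  (Cmod q < 1)%R -> s = 0%nat \/ y <> 0 -> abs_summable (qterm q A x y) ->
  abs_summable (qterm q (fun n k => A n (s + k)%nat) x y).
Proof.
intros Hq [-> | Hy]; trivial.
revert A; induction s as [|s IH]; intros A HA; trivial.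
apply (IH (fun n k => A n (S k))), (abs_summable_unscal y); trivial.
now apply qterm_summable_scal_r.
Qed.

(** This is the numerator of Jackson's quotient. Termwise the difference carries the factor
    [1 - q ^ n], which kills the terms with [n = 0], so the index shift loses nothing and
    [qterm_succ_l] applies. *)
Lemma qsum_diff_l (q : C) (A : nat -> nat -> C) (x y : C) :
  (Cmod q < 1)%R -> abs_summable (qterm q A x y) ->
  qsum q A x y - qsum q A (q * x) y = x * qsum q (fun n k => A (S n) k) x y.
Proof.
intros Hq HA; unfold qsum.
rewrite <- CSeries2_scal by now apply qterm_summable_scal_l.
rewrite <- CSeries2_minus; trivial.
2: { apply qterm_summable_le with (3 := HA); [now apply Cmod_qmult_le | apply Rle_refl]. }
rewrite (CSeries2_ext _ (fun n k => (1 - q ^ n) * qterm q A x y n k)).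
2: { intros n k; unfold qterm; rewrite Cpow_mult_l; ring. }
rewrite CSeries2_shift_l by (intros k; simpl; ring).
apply CSeries2_ext; intros n k; now apply qterm_succ_l.
Qed.

Lemma qsum_diff_r (q : C) (A : nat -> nat -> C) (x y : C) :
  (Cmod q < 1)%R -> abs_summable (qterm q A x y) ->
  qsum q A x y - qsum q A x (q * y) = y * qsum q (fun n k => A n (S k)) x y.
Proof.
intros Hq HA; unfold qsum.
rewrite <- CSeries2_scal by now apply qterm_summable_scal_r.
rewrite <- CSeries2_minus; trivial.
2: { apply qterm_summable_le with (3 := HA); [apply Rle_refl | now apply Cmod_qmult_le]. }
rewrite (CSeries2_ext _ (fun n k => (1 - q ^ k) * qterm q A x y n k)).
2: { intros n k; unfold qterm; rewrite Cpow_mult_l; ring. }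
rewrite CSeries2_shift_r by (intros n; simpl; ring).
apply CSeries2_ext; intros n k; now apply qterm_succ_r.
Qed.

(** * Iterated Jackson operators on normalised series *)

Lemma iter_qDy_qsum (q : C) (A : nat -> nat -> C) (s : nat) (x y : C) :
  (0 < Cmod q < 1)%R -> s = 0%nat \/ y <> 0 -> abs_summable (qterm q A x y) ->
  Nat.iter s (qDy q) (qsum q A) x y
  = / (1 - q) ^ s * qsum q (fun n k => A n (s + k)%nat) x y.
Proof.
intros Hq; assert (Hq0 : q <> 0) by (apply Cmod_gt_0; lra).
assert (H1q : 1 - q <> 0) by (apply one_minus_nz; lra).
revert y; induction s as [|s IH]; intros y Hy HA.
- change (qsum q A x y = / 1 * qsum q A x y); field; apply C1_nz.
- destruct Hy as [Hy|Hy]; [discriminate|].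
  simpl Nat.iter; unfold qDy at 1, qD.
  (* The induction hypothesis is used at both [y] and [q * y]; the latter is nonzero because [q] is,
     and its modulus is no larger. *)
  rewrite !IH; trivial; try (right; trivial; now apply Cmult_neq_0).
  2: { apply qterm_summable_le with (3 := HA); [apply Rle_refl | apply Cmod_qmult_le; lra]. }
  assert (E := qsum_diff_r q (fun n k => A n (s + k)%nat) x y (proj2 Hq)
    (qterm_summable_add_r q A s x y (proj2 Hq) (or_intror Hy) HA)); cbv beta in E.
  replace (qsum q (fun n k => A n (S s + k)%nat) x y)
    with (qsum q (fun n k => A n (s + S k)%nat) x y).
  2: { apply CSeries2_ext; intros n k; unfold qterm; now rewrite Nat.add_succ_r. }
  assert (Hs := Cpow_nz _ s H1q).
  (* Factoring out the common constant makes the left side of [E] appear literally. *)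
  transitivity (/ (1 - q) ^ s * (qsum q (fun n k => A n (s + k)%nat) x y
    - qsum q (fun n k => A n (s + k)%nat) x (q * y)) / ((1 - q) * y)).
  { field; now split. }
  rewrite E, Cpow_S; field; repeat split; trivial.
Qed.

(** [F] will be an iterated [y]-derivative, whose series formula is only available where summability
    is known. The disc of radius [Cmod x] suffices, since the operator in [x] evaluates [F] only at
    points [q ^ j * x]. *)
Lemma iter_qDx_qsum (q c : C) (F : C -> C -> C) (A : nat -> nat -> C) (r : nat) (x y : C) :
  (0 < Cmod q < 1)%R -> r = 0%nat \/ x <> 0 -> abs_summable (qterm q A x y) ->
  (forall x', (Cmod x' <= Cmod x)%R -> F x' y = c * qsum q A x' y) ->
  Nat.iter r (qDx q) F x y
  = c / (1 - q) ^ r * qsum q (fun n k => A (r + n)%nat k) x y.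
Proof.
intros Hq; assert (Hq0 : q <> 0) by (apply Cmod_gt_0; lra).
assert (H1q : 1 - q <> 0) by (apply one_minus_nz; lra).
revert x; induction r as [|r IH]; intros x Hx HA HF.
- change (F x y = c / 1 * qsum q A x y).
  rewrite HF by apply Rle_refl; field; apply C1_nz.
- destruct Hx as [Hx|Hx]; [discriminate|].
  assert (Hqx : (Cmod (q * x) <= Cmod x)%R) by (apply Cmod_qmult_le; lra).
  simpl Nat.iter; unfold qDx at 1, qD.
  rewrite !IH; trivial; try (right; trivial; now apply Cmult_neq_0).
  2: { apply qterm_summable_le with (3 := HA); trivial; apply Rle_refl. }
  2: { intros x' Hx'; apply HF; now apply Rle_trans with (1 := Hx'). }
  assert (E := qsum_diff_l q (fun n k => A (r + n)%nat k) x y (proj2 Hq)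
    (qterm_summable_add_l q A r x y (proj2 Hq) (or_intror Hx) HA)); cbv beta in E.
  replace (qsum q (fun n k => A (S r + n)%nat k) x y)
    with (qsum q (fun n k => A (r + S n)%nat k) x y).
  2: { apply CSeries2_ext; intros n k; unfold qterm; now rewrite Nat.add_succ_r. }
  assert (Hr := Cpow_nz _ r H1q).
  transitivity (c / (1 - q) ^ r * (qsum q (fun n k => A (r + n)%nat k) x y
    - qsum q (fun n k => A (r + n)%nat k) (q * x) y) / ((1 - q) * x)).
  { field; now split. }
  rewrite E, Cpow_S; field; repeat split; trivial.
Qed.

(** Reduces each derivative formula to a coefficient identity: the doubly shifted [A] must be a
    constant multiple of the coefficients of the target series. *)
Lemma iter_qD_qsum (q K : C) (A B : nat -> nat -> C) (r s : nat) (x y : C) :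
  (0 < Cmod q < 1)%R -> r = 0%nat \/ x <> 0 -> s = 0%nat \/ y <> 0 ->
  abs_summable (qterm q A x y) ->
  (forall n k, A (r + n)%nat (s + k)%nat = K * B n k) ->
  Nat.iter r (qDx q) (Nat.iter s (qDy q) (qsum q A)) x y
  = K / (1 - q) ^ (r + s) * qsum q B x y.
Proof.
intros Hq Hx Hy HA HB.
assert (H1q : 1 - q <> 0) by (apply one_minus_nz; lra).
assert (HAs : abs_summable (qterm q (fun n k => A n (s + k)%nat) x y))
  by (apply qterm_summable_add_r; trivial; lra).
rewrite (iter_qDx_qsum q (/ (1 - q) ^ s) _ (fun n k => A n (s + k)%nat)); trivial.
- assert (E : forall n k, qterm q (fun n k => A (r + n)%nat (s + k)%nat) x y n k
    = K * qterm q B x y n k).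
  { intros n k; unfold qterm; rewrite HB; unfold Cdiv; ring. }
  (* [K] may be 0, as happens when a numerator factorial vanishes, and then nothing follows about
     [B] alone; hence summability is claimed for the scaled family. *)
  assert (HK : abs_summable (fun n k => K * qterm q B x y n k)).
  { apply abs_summable_le with (B := 1%R)
      (u := qterm q (fun n k => A (r + n)%nat (s + k)%nat) x y); [lra| |].
    - intros n k; rewrite E; lra.
    - apply (qterm_summable_add_l q (fun n k => A n (s + k)%nat)); trivial; lra. }
  assert (Er : qsum q (fun n k => A (r + n)%nat (s + k)%nat) x y = K * qsum q B x y).
  { unfold qsum; rewrite <- CSeries2_scal by trivial; now apply CSeries2_ext. }
  rewrite Er, Cpow_add_r; field; split; now apply Cpow_nz.
- intros x' Hx'; apply iter_qDy_qsum; trivial.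
  apply qterm_summable_le with (3 := HA); trivial; apply Rle_refl.
Qed.

(** * The three Humbert series *)

Definition Phi1_coef (a b c q : C) (n k : nat) : C :=
  qpoch a q (n + k) * qpoch b q n / qpoch c q (n + k).

Definition Phi2_coef (a b c q : C) (n k : nat) : C :=
  qpoch a q n * qpoch b q k / qpoch c q (n + k).

Definition Phi3_coef (a b q : C) (n k : nat) : C :=
  qpoch a q n / qpoch b q (n + k).

(** An equality of functions, not yet applied to [x] and [y], so that it can be rewritten under the
    binders of the unfolded [Phi1]. *)
Lemma Phi1_term_qterm (a b c q : C) :
  (Cmod q < 1)%R -> (forall n, qpoch c q n <> 0) ->
  Phi1_term a b c q = qterm q (Phi1_coef a b c q).
Proof.
intros Hq Hc; do 4 (apply functional_extensionality; intro).
unfold Phi1_term, qterm, Phi1_coef; field; repeat split; auto using qpoch_self_nz.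
Qed.

Lemma Phi2_term_qterm (a b c q : C) :
  (Cmod q < 1)%R -> (forall n, qpoch c q n <> 0) ->
  Phi2_term a b c q = qterm q (Phi2_coef a b c q).
Proof.
intros Hq Hc; do 4 (apply functional_extensionality; intro).
unfold Phi2_term, qterm, Phi2_coef; field; repeat split; auto using qpoch_self_nz.
Qed.

Lemma Phi3_term_qterm (a b q : C) :
  (Cmod q < 1)%R -> (forall n, qpoch b q n <> 0) ->
  Phi3_term a b q = qterm q (Phi3_coef a b q).
Proof.
intros Hq Hb; do 4 (apply functional_extensionality; intro).
unfold Phi3_term, qterm, Phi3_coef; field; repeat split; auto using qpoch_self_nz.
Qed.

(** Keeps the denominators of the series with shifted parameters nonzero. *)
Lemma qpoch_shift_nz (c q : C) (m n : nat) :
  (forall n, qpoch c q n <> 0) -> qpoch (c * q ^ m) q n <> 0.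
Proof.
intros Hc H; apply (Hc (m + n)%nat); rewrite qpoch_add, H; ring.
Qed.

(** The disjunctions allow [r = 0] or [s = 0] with no condition on the idle variable, so this one
    formula yields both pure derivatives and the mixed one. *)
Lemma iter_qD_Phi1 (a b c q : C) (r s : nat) (x y : C) :
  (0 < Cmod q < 1)%R -> (forall n, c <> / q ^ n) ->
  abs_summable (Phi1_term a b c q x y) ->
  r = 0%nat \/ x <> 0 -> s = 0%nat \/ y <> 0 ->
  Nat.iter r (qDx q) (Nat.iter s (qDy q) (Phi1 a b c q)) x y
  = qpoch a q (r + s) * qpoch b q r / (qpoch c q (r + s) * (1 - q) ^ (r + s))
    * Phi1 (a * q ^ (r + s)) (b * q ^ r) (c * q ^ (r + s)) q x y.
Proof.
intros Hq Hc; assert (Hnz := qpoch_nz c q Hq Hc).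
assert (Hs := fun n => qpoch_shift_nz c q (r + s) n Hnz).
assert (H1q : 1 - q <> 0) by (apply one_minus_nz; lra).
unfold Phi1; rewrite !Phi1_term_qterm by (trivial; lra); intros HA Hx Hy.
change (fun x y => CSeries2 (qterm q (Phi1_coef a b c q) x y))
  with (qsum q (Phi1_coef a b c q)).
rewrite (iter_qD_qsum q (qpoch a q (r + s) * qpoch b q r / qpoch c q (r + s)) _
  (Phi1_coef (a * q ^ (r + s)) (b * q ^ r) (c * q ^ (r + s)) q)); trivial.
- unfold qsum; f_equal; field; split; [now apply Cpow_nz | trivial].
- intros n k; unfold Phi1_coef.
  (* The factorials of [a] and [c] see only the total index, so they shift by [r + s], whereas that
     of [b] shifts by [r]. *)
  replace (r + n + (s + k))%nat with (r + s + (n + k))%nat by lia.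
  rewrite !(qpoch_add _ q (r + s)), (qpoch_add b q r n); field; now split.
Qed.

Lemma iter_qD_Phi2 (a b c q : C) (r s : nat) (x y : C) :
  (0 < Cmod q < 1)%R -> (forall n, c <> / q ^ n) ->
  abs_summable (Phi2_term a b c q x y) ->
  r = 0%nat \/ x <> 0 -> s = 0%nat \/ y <> 0 ->
  Nat.iter r (qDx q) (Nat.iter s (qDy q) (Phi2 a b c q)) x y
  = qpoch a q r * qpoch b q s / (qpoch c q (r + s) * (1 - q) ^ (r + s))
    * Phi2 (a * q ^ r) (b * q ^ s) (c * q ^ (r + s)) q x y.
Proof.
intros Hq Hc; assert (Hnz := qpoch_nz c q Hq Hc).
assert (Hs := fun n => qpoch_shift_nz c q (r + s) n Hnz).
assert (H1q : 1 - q <> 0) by (apply one_minus_nz; lra).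
unfold Phi2; rewrite !Phi2_term_qterm by (trivial; lra); intros HA Hx Hy.
change (fun x y => CSeries2 (qterm q (Phi2_coef a b c q) x y))
  with (qsum q (Phi2_coef a b c q)).
rewrite (iter_qD_qsum q (qpoch a q r * qpoch b q s / qpoch c q (r + s)) _
  (Phi2_coef (a * q ^ r) (b * q ^ s) (c * q ^ (r + s)) q)); trivial.
- unfold qsum; f_equal; field; split; [now apply Cpow_nz | trivial].
- intros n k; unfold Phi2_coef.
  replace (r + n + (s + k))%nat with (r + s + (n + k))%nat by lia.
  (* Here only [c] depends on the total index; [a] follows [x] and [b] follows [y]. *)
  rewrite (qpoch_add c q (r + s)), (qpoch_add a q r), (qpoch_add b q s); field; now split.
Qed.

Lemma iter_qD_Phi3 (a b q : C) (r s : nat) (x y : C) :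
  (0 < Cmod q < 1)%R -> (forall n, b <> / q ^ n) ->
  abs_summable (Phi3_term a b q x y) ->
  r = 0%nat \/ x <> 0 -> s = 0%nat \/ y <> 0 ->
  Nat.iter r (qDx q) (Nat.iter s (qDy q) (Phi3 a b q)) x y
  = qpoch a q r / (qpoch b q (r + s) * (1 - q) ^ (r + s))
    * Phi3 (a * q ^ r) (b * q ^ (r + s)) q x y.
Proof.
intros Hq Hb; assert (Hnz := qpoch_nz b q Hq Hb).
assert (Hs := fun n => qpoch_shift_nz b q (r + s) n Hnz).
assert (H1q : 1 - q <> 0) by (apply one_minus_nz; lra).
unfold Phi3; rewrite !Phi3_term_qterm by (trivial; lra); intros HA Hx Hy.
change (fun x y => CSeries2 (qterm q (Phi3_coef a b q) x y))
  with (qsum q (Phi3_coef a b q)).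
rewrite (iter_qD_qsum q (qpoch a q r / qpoch b q (r + s)) _
  (Phi3_coef (a * q ^ r) (b * q ^ (r + s)) q)); trivial.
- unfold qsum; f_equal; field; split; [now apply Cpow_nz | trivial].
- intros n k; unfold Phi3_coef.
  replace (r + n + (s + k))%nat with (r + s + (n + k))%nat by lia.
  rewrite (qpoch_add b q (r + s)), (qpoch_add a q r); field; now split.
Qed.

Theorem theorem2p1 :
  forall (q l : C) (hq : (0 < Cmod q < 1)%R) (hl : Cexp l = q)
         (r s : nat) (x y : C),
  (forall alpha beta gamma : C,
     (forall n : nat, qpow l gamma <> / q ^ n) ->
     abs_summable (Phi1_term (qpow l alpha) (qpow l beta) (qpow l gamma) q x y) ->
     let F := Phi1 (qpow l alpha) (qpow l beta) (qpow l gamma) q in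
     (x <> 0 ->
        Nat.iter r (qDx q) F x y
        = qpoch (qpow l alpha) q r * qpoch (qpow l beta) q r
          / (qpoch (qpow l gamma) q r * (1 - q) ^ r)
          * Phi1 (qpow l (alpha + INR r)) (qpow l (beta + INR r))
                 (qpow l (gamma + INR r)) q x y)
     /\
     (y <> 0 ->
        Nat.iter s (qDy q) F x y
        = qpoch (qpow l alpha) q s
          / (qpoch (qpow l gamma) q s * (1 - q) ^ s)
          * Phi1 (qpow l (alpha + INR s)) (qpow l beta)
                 (qpow l (gamma + INR s)) q x y)
     /\
     (x <> 0 -> y <> 0 ->
        Nat.iter r (qDx q) (Nat.iter s (qDy q) F) x y
        = qpoch (qpow l alpha) q (r + s) * qpoch (qpow l beta) q r
          / (qpoch (qpow l gamma) q (r + s) * (1 - q) ^ (r + s))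
          * Phi1 (qpow l (alpha + INR r + INR s)) (qpow l (beta + INR r))
                 (qpow l (gamma + INR r + INR s)) q x y))
  /\
  (forall alpha beta gamma : C,
     (forall n : nat, qpow l gamma <> / q ^ n) ->
     abs_summable (Phi2_term (qpow l alpha) (qpow l beta) (qpow l gamma) q x y) ->
     let F := Phi2 (qpow l alpha) (qpow l beta) (qpow l gamma) q in
     (x <> 0 ->
        Nat.iter r (qDx q) F x y
        = qpoch (qpow l alpha) q r
          / (qpoch (qpow l gamma) q r * (1 - q) ^ r)
          * Phi2 (qpow l (alpha + INR r)) (qpow l beta)
                 (qpow l (gamma + INR r)) q x y)
     /\
     (y <> 0 ->
        Nat.iter s (qDy q) F x y
        = qpoch (qpow l beta) q s
          / (qpoch (qpow l gamma) q s * (1 - q) ^ s)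
          * Phi2 (qpow l alpha) (qpow l (beta + INR s))
                 (qpow l (gamma + INR s)) q x y)
     /\
     (x <> 0 -> y <> 0 ->
        Nat.iter r (qDx q) (Nat.iter s (qDy q) F) x y
        = qpoch (qpow l alpha) q r * qpoch (qpow l beta) q s
          / (qpoch (qpow l gamma) q (r + s) * (1 - q) ^ (r + s))
          * Phi2 (qpow l (alpha + INR r)) (qpow l (beta + INR s))
                 (qpow l (gamma + INR r + INR s)) q x y))
  /\
  (forall alpha beta : C,
     (forall n : nat, qpow l beta <> / q ^ n) ->
     abs_summable (Phi3_term (qpow l alpha) (qpow l beta) q x y) ->
     let F := Phi3 (qpow l alpha) (qpow l beta) q in
     (x <> 0 ->
        Nat.iter r (qDx q) F x y
        = qpoch (qpow l alpha) q r
          / (qpoch (qpow l beta) q r * (1 - q) ^ r)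
          * Phi3 (qpow l (alpha + INR r)) (qpow l (beta + INR r)) q x y)
     /\
     (y <> 0 ->
        Nat.iter s (qDy q) F x y
        = 1 / (qpoch (qpow l beta) q s * (1 - q) ^ s)
          * Phi3 (qpow l alpha) (qpow l (beta + INR s)) q x y)
     /\
     (x <> 0 -> y <> 0 ->
        Nat.iter r (qDx q) (Nat.iter s (qDy q) F) x y
        = qpoch (qpow l alpha) q r
          / (qpoch (qpow l beta) q (r + s) * (1 - q) ^ (r + s))
          * Phi3 (qpow l (alpha + INR r)) (qpow l (beta + INR r + INR s)) q x y)).
Proof.
intros q l hq hl r s x y; split; [|split].
- intros alpha beta gamma Hc HA F.
  assert (H := fun r s => iter_qD_Phi1 _ _ _ q r s x y hq Hc HA).
  rewrite !(qpow_add_INR q l) by trivial; repeat split.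
  (* A pure derivative is the mixed formula with the other order set to 0. *)
  + intros Hx; specialize (H r 0%nat (or_intror Hx) (or_introl eq_refl)).
    now rewrite Nat.add_0_r in H.
  + intros Hy; specialize (H 0%nat s (or_introl eq_refl) (or_intror Hy)).
    simpl in H; now rewrite !Cmult_1_r in H.
  (* Adding [INR r] and then [INR s] to an exponent produced [q ^ r * q ^ s], merged here into
     [q ^ (r + s)]. *)
  + intros Hx Hy; rewrite <- !Cmult_assoc, <- Cpow_add_r; apply H; now right.
- intros alpha beta gamma Hc HA F.
  assert (H := fun r s => iter_qD_Phi2 _ _ _ q r s x y hq Hc HA).
  rewrite !(qpow_add_INR q l) by trivial; repeat split.
  + intros Hx; specialize (H r 0%nat (or_intror Hx) (or_introl eq_refl)).
    simpl in H; now rewrite Nat.add_0_r, !Cmult_1_r in H.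
  + intros Hy; specialize (H 0%nat s (or_introl eq_refl) (or_intror Hy)).
    simpl in H; now rewrite Cmult_1_l, Cmult_1_r in H.
  + intros Hx Hy; rewrite <- !Cmult_assoc, <- Cpow_add_r; apply H; now right.
- intros alpha beta Hb HA F.
  assert (H := fun r s => iter_qD_Phi3 _ _ q r s x y hq Hb HA).
  rewrite !(qpow_add_INR q l) by trivial; repeat split.
  + intros Hx; specialize (H r 0%nat (or_intror Hx) (or_introl eq_refl)).
    now rewrite Nat.add_0_r in H.
  + intros Hy; specialize (H 0%nat s (or_introl eq_refl) (or_intror Hy)).
    simpl in H; now rewrite Cmult_1_r in H.
  + intros Hx Hy; rewrite <- !Cmult_assoc, <- Cpow_add_r; apply H; now right.
Qed.
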